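(* Let $\mathsf{k}$ be an infinite field and let $T=(t_0,t_1,\dots,t_j)=(1,3,T_1,s^k,T_1^r,3,1)$ be a codimension three Gorenstein sequence whose maximum value $s$ occurs at least $3$ times, $t_a=t_{a+1}=\cdots=t_b=s$. Let $A\in\mathrm{Gor}(T)$ and let $\ell\in A_1$ be any linear form. Then for every $p\ge 0$ the rank of the multiplication map $\ell^p: A_i\to A_{i+p}$ is independent of $i$ for $a\le i\le b-p$. Equivalently, in the rank matrix $M_{A,\ell}$, each diagonal parallel to the main diagonal is constant within the square corresponding to those degrees $i$ for which $t_i=s$.
   Context: $R=\mathsf{k}[x,y,z]$ with the standard grading. A codimension three Gorenstein sequence is the Hilbert function of a graded Artinian Gorenstein (AG) quotient $A=R/I$ with $A_1$ of dimension $3$; such a sequence can be written $T=(1,3,T_1,s^k,T_1^r,3,1)$, where $s$ is its maximum value (Sperner number), $s^k$ means $s$ repeated $k$ times, $T_1^r$ is the reverse of $T_1$, and the first difference of $(1,3,T_1,s)$ is the Hilbert function of a graded Artinian algebra of codimension two. $\mathrm{Gor}(T)$ is the family of graded AG quotients of $R$ with Hilbert function $T$. The rank matrix $M_{A,\ell}$ is the $(j+1)\times(j+1)$ upper triangular matrix with rows and columns indexed by $0,\dots,j$ whose $(u,v)$ entry, $u\le v$, is the rank of $\ell^{v-u}:A_u\to A_v$. *)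

(* Defs.v *)
From mathcomp Require Import all_boot all_order all_algebra all_field.
From mathcomp.multinomials Require Import mpoly.

Set Implicit Arguments.
Unset Strict Implicit.
Unset Printing Implicit Defensive.

Import GRing.Theory.
Local Open Scope ring_scope.

(* A graded Artinian quotient of R = K[x, y, z], given by a surjective
   K-algebra morphism R -> A with homogeneous kernel I, so that A = R/I.
   A finitely generated K-algebra is Artinian iff it is finite dimensional
   over K, which is built into falgType. *)
Record gradedArtinianQuotient (K : fieldType) := GradedArtinianQuotient {
  quot_alg :> falgType K;
  quot_proj : {lrmorphism {mpoly K[3]} -> quot_alg};
  quot_proj_surj : forall a : quot_alg, exists f, quot_proj f = a;
  quot_ker_homog : forall (f : {mpoly K[3]}) (d : nat),
    quot_proj f = 0 -> quot_proj (pihomog mdeg d f) = 0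
}.

Section Graded.
Variables (K : fieldType) (A : gradedArtinianQuotient K).

Definition gpart (i : nat) : {vspace A} :=
  limg (linfun (@quot_proj K A \o @mpoly_of_dhomog 3 K i)).

Lemma mem_gpart (i : nat) (a : A) :
  a \in gpart i <->
  exists2 f : {mpoly K[3]}, f \is i.-homog & a = quot_proj A f.
Proof.
split=> [/memv_imgP[f _ ->]|[f hf ->]].
  by exists (mpoly_of_dhomog f); [exact: dhomog_is_dhomog | rewrite lfunE].
apply/memv_imgP; exists (DHomog hf); first exact: memvf.
by rewrite lfunE.
Qed.

(* (0 : m_A), where m_A is generated by the images of x, y, z
   (see mem_gsocle) *)
Definition gsocle : {vspace A} :=
  (\bigcap_(i < 3) lker (amull (quot_proj A 'X_i)))%VS.

Lemma mem_gsocle (a : A) :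
  a \in gsocle <->
  (forall f : {mpoly K[3]}, f@_0%MM = 0 -> quot_proj A f * a = 0).
Proof.
split=> [sa f f0|ha].
  have xa i : quot_proj A 'X_i * a = 0.
    apply/eqP; have: a \in lker (amull (quot_proj A 'X_i)).
      by apply: subvP sa; apply: bigcapv_inf (subvv _).
    by rewrite memv_ker lfunE.
  rewrite (mpolyE f) linear_sum mulr_suml big1_seq // => m /andP[_ mf].
  have m0 : m != 0%MM.
    by apply: contraTneq mf => ->; rewrite mcoeff_msupp f0 eqxx.
  have [i mi] : exists i, m i != 0%N.
    apply/existsP; apply: contraNT m0; rewrite negb_exists => /forallP h.
    by apply/eqP/mnmP => i; rewrite mnm0E; apply/eqP; rewrite -[_ == _]negbK h.
  have -> : m = (m - U_(i) + U_(i))%MM.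
    by rewrite submK // lep1mP.
  by rewrite linearZ /= mpolyXD rmorphM -scalerAl -mulrA xa mulr0 scaler0.
rewrite memvE; apply/subv_bigcapP => i _; rewrite -memvE memv_ker lfunE /=.
by rewrite ha // mcoeffX mnm1_eq0.
Qed.

Definition gorenstein : Prop := \dim gsocle = 1%N.

Definition hilbert_function (i : nat) : nat := \dim (gpart i).

(* A \in Gor(T); the entries t_i with i >= size T are 0 *)
Definition in_Gor (T : seq nat) : Prop :=
  gorenstein /\ (forall i, hilbert_function i = nth 0%N T i).

(* the rank of l^p : A_i -> A_(i+p) *)
Definition mult_rank (l : A) (p i : nat) : nat :=
  \dim (amull (l ^+ p) @: gpart i).

Definition rank_matrix (l : A) (j : nat) : 'M[nat]_(j.+1) :=
  \matrix_(u, v) if (u <= v)%N then mult_rank l (v - u) u else 0%N.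

End Graded.

Definition codim3_gorenstein_seq (K : fieldType) (T : seq nat) : Prop :=
  exists A : gradedArtinianQuotient K,
    in_Gor A T /\ hilbert_function A 1 = 3%N.

(* Main.v *)
Require Import Defs.
From HB Require Import structures.
From mathcomp Require Import all_boot all_order all_algebra all_field.
From mathcomp.multinomials Require Import mpoly.
From mathcomp Require Import ring zify.
From Stdlib Require Import Classical.

Set Implicit Arguments.
Unset Strict Implicit.
Unset Printing Implicit Defensive.

Import GRing.Theory.

(** Why the rank of l^p is constant.  Multiplication by l^p commutes with
    multiplication by any w in A_1, so it suffices to find w such that
    w : A_i -> A_(i+1) is bijective for a <= i < b.  As A is generated in degree
    1 and all these spaces have dimension s, it is enough that w A_a = A_(a+1).
    The lemma exists_surjective_linear_form finds such a w.

    The socle pairing A_i x A_(j-i) -> A_j is perfect.  Hence multiplication by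
    a form of degree d has the same rank on A_i and on A_(j-d-i)
    (rank_duality); for d = 0 this gives a + b = j.

    Since dim A_a = dim A_(a+1), some nonzero form of degree a+1 vanishes in A.
    As K is infinite, coordinates x, y, z can be chosen so that x^(a+1) occurs
    in it; then A_(m+1) = y A_m + z A_m for m >= a.  Consider the pencil
    h_c = y - c z.  The map z : (A/h_c)_m -> (A/h_c)_(m+1) is onto for m > a,
    so the dimension of (A/h_c)_m does not increase from m = a+1 to m = b.
    By rank_duality it is the same at both ends, hence constant, and because
    b >= a+2 the map z is bijective from degree a+1 to degree a+2
    (pencil_quotient_inj).  It follows that the polynomials in x of degree at
    most a+1 whose homogenization by z vanishes in A/h_c form the truncation of
    an ideal (chi_c) of K[x].  If chi_c is constant for some c, then
    w = h_c is the form sought.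

    Otherwise, for every c, the nonconstant chi_c divides F(x, c) for all F in
    I_(a+1), where I is the kernel of K[x, y, z] -> A and forms are written with
    z = 1 (pencil_common_divisor).  The elements of I_(a+1) are then not coprime
    over K(y), and by Gauss's lemma they have a common factor G in K[x, y] of
    positive total degree e (ideal_common_factor).  This is impossible
    (no_common_factor).  Let g be the value of G in A.  In degrees a and a+1
    the algebra A/gA coincides with the quotient of K[x, y, z] by G, whose
    Hilbert function is increasing; as dim A_a = dim A_(a+1), this forces
    dim g A_(a+1-e) < dim g A_(a-e).  On the other hand gA is, up to a shift,
    the Gorenstein algebra A/(0 : g) of socle degree j-e, and 2 (a+1-e) <= j-e;
    the Hilbert function of a Gorenstein algebra in three variables does not
    decrease before the middle, by the same comparison of quotients by a linear
    form with rank_duality, so dim g A_(a-e) <= dim g A_(a+1-e).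

    Polynomials in K[x, y] are represented in {poly {poly K}}, the outer variable
    being x. *)

Local Open Scope ring_scope.

(** * Dimension count and minimal choices *)

Lemma dim_preim_add (K : fieldType) (V : vectType K) (f : 'End(V))
    (U W : {vspace V}) :
  (\dim (U :&: f @^-1: W) + \dim (f @: U + W) = \dim U + \dim W)%N.
Proof.
have kU : (U :&: (f @^-1: W) :&: lker f = U :&: lker f)%VS.
  by rewrite -capvA; congr (_ :&: _)%VS; apply/capv_idPr; rewrite -lpreim0 lpreimS ?sub0v.
have iU : (f @: (U :&: f @^-1: W) = (f @: U) :&: W)%VS.
  apply/eqP; rewrite eqEsubv; apply/andP; split; apply/subvP=> y.
    case/memv_imgP=> x /memv_capP[xU xW] ->.
    by rewrite memv_cap memv_img //= memv_preim.
  case/memv_capP=> /memv_imgP[x xU ->] xW.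
  by rewrite memv_img // memv_cap xU -memv_preim.
have h1 := limg_ker_dim f (U :&: f @^-1: W).
have h2 := limg_ker_dim f U.
have h3 := dimv_sum_cap (f @: U) W.
rewrite kU iU in h1.
lia.
Qed.

Lemma ex_min_measure (T : Type) (m : T -> nat) (Q : T -> Prop) :
  (exists x, Q x) -> exists2 x, Q x & forall y, Q y -> (m x <= m y)%N.
Proof.
case=> x; have [n] := ubnP (m x); elim: n x => // n IHn x; rewrite ltnS => xn Qx.
case: (classic (exists2 y, Q y & m y < m x)%N) => [[y Qy yx]|nex].
  by apply: (IHn y) => //; apply: leq_trans yx xn.
exists x => // y Qy; rewrite leqNgt; apply/negP => yx; apply: nex; by exists y.
Qed.

(** * Common factors of bivariate polynomials *)

Section CommonFactor.
Variable K : fieldType.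
Local Notation P2 := {poly {poly K}}.

(** A nonzero element of least size divides all others: the remainder of a
    division stays in [V], because the quotient times the divisor has size at
    most [N] and is reached from the divisor by products with ['X]. *)
Lemma truncated_ideal (V : {poly K} -> Prop) (N : nat) :
    (forall c P Q, V P -> V Q -> V (c *: P + Q)) ->
    (forall P, V P -> (size P <= N)%N) ->
    (forall P, V P -> (size P < N)%N -> V ('X * P)) ->
    (exists2 P, V P & P != 0) ->
  exists2 chi, chi != 0 & forall P, V P <-> (size P <= N)%N /\ chi %| P.
Proof.
move=> Vlin Vsize VX Vn0.
have [chi [Vchi chi0] chi_min] :=
  @ex_min_measure _ (fun P : {poly K} => size P) (fun P => V P /\ P != 0)
    (let: ex_intro2 P VP P0 := Vn0 in ex_intro _ P (conj VP P0)).
have V0 : V 0 by have := Vlin (-1) _ _ Vchi Vchi; rewrite scaleN1r addNr.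
have VXn n : (n + size chi <= N)%N -> V ('X^n * chi).
  elim: n => [|n IHn] nN; first by rewrite expr0 mul1r.
  rewrite exprS -mulrA; apply: VX; first by apply: IHn; apply: leq_trans nN; rewrite leq_add2r.
  by rewrite size_mul ?expf_neq0 ?polyX_eq0 // size_polyXn addSn.
have VM (Q : {poly K}) : (size Q + (size chi).-1 <= N)%N -> V (Q * chi).
  move=> QN; rewrite -[Q]coefK poly_def mulr_suml.
  have: forall i : 'I_(size Q), true -> V ('X^i * chi).
    move=> i _; apply: VXn; have := ltn_ord i.
    have := size_poly_eq0 chi; rewrite (negbTE chi0); lia.
  elim/big_rec: _ => // i x _ Vx H; rewrite -scalerAl; apply: Vlin; first exact: H.
  exact: Vx.
have quotV (P : {poly K}) : (size P <= N)%N -> V (P %/ chi * chi).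
  move=> PN; have [->|q0] := eqVneq (P %/ chi) 0; first by rewrite mul0r.
  apply: VM; apply: leq_trans PN; rewrite size_divp //.
  have : (size chi <= size P)%N by rewrite leqNgt; apply: contraNN q0 => /divp_small ->.
  by move=> le; rewrite subnK // (leq_trans (leq_pred _)).
exists chi => // P; split=> [VP|[PN chiP]]; last by rewrite -(divpK chiP); apply: quotV.
split; first exact: Vsize.
rewrite /dvdp; apply/negPn/negP => nz.
have VR : V (P %% chi).
  have -> : P %% chi = (-1) *: (P %/ chi * chi) + P.
    by rewrite {3}(divp_eq P chi) scaleN1r addKr.
  by apply: Vlin => //; apply/quotV/Vsize.
have := chi_min _ (conj VR nz); rewrite leqNgt ltn_modp chi0; exact/negP.
Qed.

Lemma exists_irreducible_factor (p : {poly K}) :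
  (1 < size p)%N -> exists2 q, irreducible_poly q & q %| p.
Proof.
move=> p1.
have [q [q1 qp] q_min] :=
  @ex_min_measure _ (fun q : {poly K} => size q) (fun q => (1 < size q)%N /\ q %| p)
    (ex_intro _ p (conj p1 (dvdpp p))).
exists q => //; split=> // r r1 rq.
have q0 : q != 0 by rewrite -size_poly_gt0; apply: leq_trans q1.
rewrite -dvdp_size_eqp // eqn_leq dvdp_leq //=.
apply: q_min; split; last exact: dvdp_trans rq qp.
have r0 : r != 0 by apply: contraTneq rq => ->; rewrite dvd0p.
by rewrite ltn_neqAle eq_sym r1 size_poly_gt0.
Qed.

(** Gauss's lemma: reducing the coefficients mod [q] removes the terms divisible
    by [q], after which the leading coefficient of the product witnesses that
    the product is nonzero mod [q]. *)
Lemma gauss_prime (q : {poly K}) (F G : P2) : irreducible_poly q ->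
  (forall i, q %| (F * G)`_i) ->
  (forall i, q %| F`_i) \/ (forall i, q %| G`_i).
Proof.
move=> irr_q qFG.
pose md := map_poly (fun c : {poly K} => c %% q).
pose dv := map_poly (fun c : {poly K} => c %/ q).
have mdE (H : P2) i : (md H)`_i = H`_i %% q by rewrite coef_map_id0 ?mod0p.
have dvE (H : P2) i : (dv H)`_i = H`_i %/ q by rewrite coef_map_id0 ?div0p.
have HE (H : P2) : H = q *: dv H + md H.
  by apply/polyP=> i; rewrite coefD coefZ mdE dvE mulrC -divp_eq.
have [mF0|mF0] := eqVneq (md F) 0.
  by left=> i; rewrite /dvdp -mdE mF0 coef0.
have [mG0|mG0] := eqVneq (md G) 0.
  by right=> i; rewrite /dvdp -mdE mG0 coef0.
have : q %| lead_coef (md F) * lead_coef (md G).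
  rewrite -lead_coefM lead_coefE; set n := _.-1.
  have -> : md F * md G = F * G - q *: (dv F * G + md F * dv G).
    move: (HE F) (HE G); move: (md F) (dv F) (md G) (dv G) => f f' g g'.
    by rewrite -!mul_polyC => -> ->; ring.
  by rewrite coefB coefZ dvdp_sub // dvdp_mulr.
have modlc (H : P2) : md H != 0 -> coprimep q (lead_coef (md H)).
  move=> H0; rewrite irreducible_poly_coprime //.
  rewrite lead_coefE mdE /dvdp modp_id -mdE -lead_coefE.
  by rewrite lead_coef_eq0.
rewrite Gauss_dvdpl ?modlc // => qF.
by have := modlc _ mF0; rewrite irreducible_poly_coprime // qF.
Qed.

Lemma dvd_coef_scale (q : {poly K}) (F : P2) :
  (forall i, q %| F`_i) -> exists F' : P2, F = q *: F'.
Proof.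
move=> qF; exists (map_poly (fun c : {poly K} => c %/ q) F).
by apply/polyP=> i; rewrite coefZ coef_map_id0 ?div0p // mulrC divpK.
Qed.

(** In K(y)[x] the ideal generated by [J] is principal, and proper because [J]
    contains no nonzero constant in [x].  A generator divides every element of
    [J] up to a nonzero factor in K[y]; Gauss's lemma removes this factor once
    the generator is primitive. *)
Lemma common_factor (J : P2 -> Prop) :
    (forall F G, J F -> J G -> J (F - G)) ->
    (forall H F, J F -> J (H * F)) ->
    (forall c : {poly K}, J c%:P -> c = 0) ->
    (exists2 F, J F & F != 0) ->
  exists2 G : P2, (1 < size G)%N & forall F, J F -> exists Q : P2, F = G * Q.
Proof.
move=> JB JM Jc Jn0.
have [G0 [JG0 G0n0] G0min] :=
  @ex_min_measure _ (fun P : P2 => size P) (fun P => J P /\ P != 0)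
    (let: ex_intro2 P VP P0 := Jn0 in ex_intro _ P (conj VP P0)).
pose D (G : P2) := (1 < size G)%N /\
  forall F, J F -> exists2 u : {poly K}, u != 0 & exists Q : P2, u *: F = G * Q.
have DG0 : D G0.
  split.
    rewrite ltnNge; apply: contraNN G0n0 => /size1_polyC G0E.
    by rewrite G0E in JG0 *; rewrite (Jc _ JG0).
  move=> F JF; have E := Pdiv.Idomain.divp_eq F G0.
  exists (lead_coef G0 ^+ Pdiv.Idomain.scalp F G0).
    by rewrite expf_neq0 // lead_coef_eq0.
  exists (F %/ G0); rewrite E.
  suff -> : F %% G0 = 0 by rewrite addr0 mulrC.
  apply/eqP/negPn/negP => nz.
  have JR : J (F %% G0).
    have -> : F %% G0 = (lead_coef G0 ^+ scalp F G0)%:P * F - F %/ G0 * G0.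
      by rewrite mul_polyC E addrC addKr.
    by apply: JB; apply: JM.
  by have := G0min _ (conj JR nz); rewrite leqNgt ltn_modp G0n0.
(* Among the divisors up to K[y], least size of the leading coefficient enforces
   primitivity. *)
have [G [G1 DG] Gmin] :=
  @ex_min_measure _ (fun G : P2 => size (lead_coef G)) D (ex_intro _ _ DG0).
have G0' : G != 0 by rewrite -size_poly_gt0; apply: leq_trans G1.
have Gprim q : irreducible_poly q -> ~ (forall i, q %| G`_i).
  move=> irr_q qG; have q0 := irredp_neq0 irr_q.
  have [G' GE] := dvd_coef_scale qG.
  have sG : size G = size G' by rewrite GE size_scale.
  have := Gmin G'; rewrite {1}GE lead_coefZ.
  rewrite size_mul ?lead_coef_eq0 //; last first.
    by rewrite -size_poly_eq0 -sG size_poly_eq0.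
  have q1 : (1 < size q)%N by case: irr_q.
  suff H : D G'.
    move/(_ H); move: q1; case: (size q) => [|[|n]] // _.
    by rewrite !addSn /= ltnNge leq_addl.
  split; first by rewrite -sG.
  move=> F /DG[u u0 [Q uF]]; exists u => //; exists (q *: Q).
  by rewrite uF {1}GE -scalerAl -scalerAr.
exists G => // F JF.
have [u [u0 [Q uF]] umin] := @ex_min_measure _ (fun u : {poly K} => size u)
  (fun u => u != 0 /\ exists Q : P2, u *: F = G * Q)
  (let: ex_intro2 u u0 uQ := DG _ JF in ex_intro _ u (conj u0 uQ)).
have [u1|] := leqP (size u) 1.
  have uE := size1_polyC u1; move: uF u0; rewrite uE polyC_eq0 => uF u0.
  exists ((u`_0)^-1%:P *: Q); rewrite -scalerAr -uF scalerA -polyCM.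
  by rewrite mulVf // scale1r.
case/exists_irreducible_factor=> q irr_q qu; have q0 := irredp_neq0 irr_q.
have : (forall i, q %| G`_i) \/ (forall i, q %| Q`_i).
  by apply: gauss_prime => // i; rewrite -uF coefZ dvdp_mulr.
case=> [/(Gprim _ irr_q) //|qQ].
have [Q' QE] := dvd_coef_scale qQ.
have uE : u = q * (u %/ q) by rewrite mulrC divpK.
have u'0 : u %/ q != 0 by apply: contraNneq u0 => u0; rewrite uE u0 mulr0.
have : (size u <= size (u %/ q)%R)%N.
  apply: umin; split=> //; exists Q'.
  have qinj : injective (fun H : P2 => q *: H).
    move=> H1 H2 /eqP; rewrite -subr_eq0 -scalerBr scale_poly_eq0 (negbTE q0) /=.
    by rewrite subr_eq0 => /eqP.
  by apply: qinj; rewrite /= scalerA -uE uF QE scalerAr.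
have q1 : (1 < size q)%N by case: irr_q.
rewrite {1}uE size_mul //; move: q1; case: (size q) => [|[|n]] // _.
by rewrite !addSn /= ltnNge leq_addl.
Qed.

Lemma poly0_of_infinite (c : {poly K}) :
    (forall e : seq K, exists t : K, t \notin e) ->
  (forall t, c.[t] = 0) -> c = 0.
Proof.
move=> K_infinite c0; apply/eqP/negPn/negP => cn0.
have [rs urs srs] : exists2 rs : seq K, uniq rs & size rs = size c.
  elim: (size c) => [|n [rs urs srs]]; first by exists [::].
  have [t tn] := K_infinite rs; exists (t :: rs); rewrite /= ?srs // tn //.
have := max_poly_roots cn0 _ urs; rewrite srs ltnn => H.
by have : false by apply: H; apply/allP => t _; rewrite /root c0.
Qed.

End CommonFactor.

(** * Total degree *)

Section TotalDegree.
Variable K : fieldType.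
Local Notation P2 := {poly {poly K}}.

Definition tdeg_le (d : nat) (F : P2) : Prop :=
  forall i l, (d < i + l)%N -> F`_i`_l = 0.

(** F(x t, t), with outer variable t: its degree in t is the total degree of F
    and its coefficient of t^m is the degree m part of F at y = 1.  The
    substitution is a ring morphism, which is why total degree is additive. *)
Definition bigrade (F : P2) : P2 := (map_poly (map_poly polyC) F).['X%:P * 'X].

Lemma coef_bigrade (F : P2) m i :
  (bigrade F)`_m`_i = if (i <= m)%N then F`_i`_(m - i) else 0.
Proof.
rewrite /bigrade horner_coef coef_sum coef_sum size_map_inj_poly ?rmorph0 //; last first.
  by apply: map_inj_poly => //; apply: polyC_inj.
have E k : ((map_poly (map_poly polyC) F)`_k * ('X%:P * 'X) ^+ k)`_m`_i
    = if (k == i) && (i <= m)%N then F`_i`_(m - i) else 0.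
  rewrite coef_map /= exprMn -rmorphXn mulrA coefMXn ltnNge.
  case: leqP => [km|mk] /=.
    rewrite coefMC coef_map /= mul_polyC coefZ coefXn eq_sym.
    by case: eqVneq => [<-|_]; rewrite ?km ?mulr1 ?mulr0.
  rewrite coef0; case: eqVneq => //= <-; by rewrite leqNgt mk.
have [iF|Fi] := ltnP i (size F).
  rewrite (bigD1 (Ordinal iF)) //= E eqxx /= big1 ?addr0 // => k.
  by rewrite -val_eqE /= E => /negbTE ->.
rewrite big1; first by rewrite (nth_default _ Fi) coef0 if_same.
move=> k _; rewrite E; case: eqVneq => //= ki.
by move: (ltn_ord k); rewrite ki ltnNge Fi.
Qed.

Lemma bigradeM : {morph bigrade : F G / F * G}.
Proof. by move=> F G; rewrite /bigrade rmorphM /= hornerM. Qed.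

Lemma bigrade_eq0 (F : P2) : (bigrade F == 0) = (F == 0).
Proof.
apply/eqP/eqP => [F0|->]; last by rewrite /bigrade rmorph0 horner0.
apply/polyP=> i; apply/polyP=> l; rewrite coef0.
by have := coef_bigrade F (i + l) i; rewrite leq_addr addKn F0 !coef0.
Qed.

Lemma tdeg_leP d (F : P2) : tdeg_le d F <-> (size (bigrade F) <= d.+1)%N.
Proof.
split=> [Fd|/leq_sizeP Fd i l dil].
  apply/leq_sizeP => m dm; apply/polyP=> i; rewrite coef0 coef_bigrade.
  by case: leqP => // im; rewrite Fd // subnKC.
by have := coef_bigrade F (i + l) i; rewrite leq_addr addKn Fd // !coef0.
Qed.

Definition tdeg (F : P2) := (size (bigrade F)).-1.

Lemma tdeg_le_tdeg F : tdeg_le (tdeg F) F.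
Proof. by apply/tdeg_leP; rewrite /tdeg leqSpred. Qed.

Lemma tdeg_leM d e F G : tdeg_le d F -> tdeg_le e G -> tdeg_le (d + e) (F * G).
Proof.
move=> /tdeg_leP Fd /tdeg_leP Ge; apply/tdeg_leP; rewrite bigradeM.
apply: leq_trans (size_polyMleq _ _) _.
by rewrite -subn1 leq_subLR add1n -addSn -addnS leq_add.
Qed.

Lemma tdeg_le_factor d G Q : G != 0 -> Q != 0 -> tdeg_le d (G * Q) ->
  (tdeg G <= d)%N /\ tdeg_le (d - tdeg G) Q.
Proof.
move=> G0 Q0 /tdeg_leP; rewrite bigradeM size_mul ?bigrade_eq0 //.
have G1 : (0 < size (bigrade G))%N by rewrite size_poly_gt0 bigrade_eq0.
have Q1 : (0 < size (bigrade Q))%N by rewrite size_poly_gt0 bigrade_eq0.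
move: G1 Q1; rewrite /tdeg => G1 Q1 GQ.
suff [sG sQ] : ((size (bigrade G)).-1 <= d)%N /\
    (size (bigrade Q) <= (d - (size (bigrade G)).-1).+1)%N.
  by split=> //; apply/tdeg_leP.
move: (size (bigrade G)) (size (bigrade Q)) G1 Q1 GQ => m n; lia.
Qed.

Lemma tdeg_gt0 (G : P2) : (1 < size G)%N -> (0 < tdeg G)%N.
Proof.
move=> G1; rewrite lt0n; apply/negP => /eqP G0.
have G0' : G != 0 by rewrite -size_poly_gt0; apply: leq_trans G1.
have : lead_coef G != 0 by rewrite lead_coef_eq0.
apply/negP/negPn/eqP/polyP => l; rewrite coef0 lead_coefE.
by apply: tdeg_le_tdeg; rewrite G0; lia.
Qed.

Definition bimono (c : K) (i l : nat) : P2 := (c *: 'X^l) *: 'X^i.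

Lemma coef_bimono c i l i' l' :
  (bimono c i l)`_i'`_l' = c * ((i' == i) && (l' == l))%:R.
Proof.
rewrite /bimono coefZ coefXn; case: eqVneq => _ /=; last by rewrite mulr0 coef0 mulr0.
by rewrite mulr1 coefZ coefXn.
Qed.

Lemma bimonoM c i l c' i' l' :
  bimono c i l * bimono c' i' l' = bimono (c * c') (i + i') (l + l').
Proof.
rewrite /bimono -scalerAl -scalerAr scalerA -exprD; congr (_ *: _).
by rewrite -scalerAl -scalerAr scalerA -exprD.
Qed.

Lemma tdeg_le_ind (d : nat) (Q : P2 -> Prop) :
    Q 0 -> (forall F G, Q F -> Q G -> Q (F + G)) ->
    (forall c i l, (i + l <= d)%N -> Q (bimono c i l)) ->
  forall F, tdeg_le d F -> Q F.
Proof.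
move=> Q0 QD Qm F Fd; rewrite -[F]coefK poly_def.
elim/big_ind: _ => // i _; rewrite -[F`_i]coefK poly_def scaler_suml.
elim/big_ind: _ => // l _; have [|dil] := leqP (i + l) d; first exact: Qm.
by rewrite Fd // scale0r scale0r.
Qed.

Lemma tdeg_leD d F G : tdeg_le d F -> tdeg_le d G -> tdeg_le d (F + G).
Proof. by move=> Fd Gd i l il; rewrite !coefD Fd // Gd // addr0. Qed.

Lemma tdeg_leN d F : tdeg_le d F -> tdeg_le d (- F).
Proof. by move=> Fd i l il; rewrite !coefN Fd // oppr0. Qed.

Lemma tdeg_leB d F G : tdeg_le d F -> tdeg_le d G -> tdeg_le d (F - G).
Proof. by move=> Fd /tdeg_leN; apply: tdeg_leD. Qed.

Lemma tdeg_le_bimono d c i l : (i + l <= d)%N -> tdeg_le d (bimono c i l).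
Proof.
move=> ild i' l' di; rewrite coef_bimono; case: andP => [[/eqP i'E /eqP l'E]|].
  by move: di; rewrite i'E l'E ltnNge ild.
by rewrite mulr0.
Qed.

Lemma tdeg_le_widen d e F : (d <= e)%N -> tdeg_le d F -> tdeg_le e F.
Proof. by move=> de Fd i l /(leq_ltn_trans de); apply: Fd. Qed.

Definition restr (c : K) (F : P2) : {poly K} := map_poly (horner_eval c) F.

Lemma tdeg_le_map_polyC d (P : {poly K}) :
  (size P <= d.+1)%N -> tdeg_le d (map_poly polyC P).
Proof.
move=> Pd i l il; rewrite coef_map coefC; case: eqVneq => // l0.
by rewrite nth_default //; move: il; rewrite l0 addn0; apply: leq_trans.
Qed.

Lemma size_restr d c F : tdeg_le d F -> (size (restr c F) <= d.+1)%N.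
Proof.
move=> Fd; apply/leq_sizeP => i di; rewrite coef_map /=.
suff -> : F`_i = 0 by rewrite rmorph0.
by apply/polyP=> l; rewrite coef0 Fd // ltn_addr.
Qed.

(** Division by y - c, which lowers the total degree. *)
Lemma restr_decomp d c F : tdeg_le d.+1 F ->
  exists2 Q, tdeg_le d Q &
    F = map_poly polyC (restr c F) + (bimono 1 0 1 - bimono c 0 0) * Q.
Proof.
move=> Fd; pose Q := map_poly (fun p : {poly K} => (p - (p.[c])%:P) %/ ('X - c%:P)) F.
have yc : bimono 1 0 1 - bimono c 0 0 = ('X - c%:P)%:P.
  by rewrite /bimono !expr0 !scale1r expr1 alg_polyC polyCB !alg_polyC.
have E : F = map_poly polyC (restr c F) + ('X - c%:P)%:P * Q.
  apply/polyP=> i; rewrite coefD mul_polyC coefZ !coef_map /=.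
  rewrite coef_map_id0 ?horner0 ?subrr ?div0p // mulrC divpK ?subrKC //.
  by rewrite dvdp_XsubCl /root !hornerE subrr.
clearbody Q; exists Q; last by rewrite yc.
have [->|Q0] := eqVneq Q 0; first by move=> i l _; rewrite !coef0.
have := @tdeg_le_factor d.+1 ('X - c%:P)%:P Q; rewrite polyC_eq0 polyXsubC_eq0.
have -> : tdeg ('X - c%:P)%:P = 1%N.
  by rewrite /tdeg /bigrade map_polyC hornerC /= rmorphB /= map_polyX map_polyC size_XsubC.
rewrite subn1; case=> //.
have -> : ('X - c%:P)%:P * Q = F - map_poly polyC (restr c F).
  by rewrite {1}E [RHS]addrC addKr.
apply: tdeg_leB => //; apply: tdeg_le_map_polyC; exact: size_restr.
Qed.

(** The scalar [(restr p2 F).[p1]] is F(p1, p2). *)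
Lemma restr_nonvanishing (F : P2) :
    (forall e : seq K, exists t : K, t \notin e) -> F != 0 ->
  exists p1, exists p2, (restr p2 F).[p1] != 0.
Proof.
move=> K_infinite F0; apply: NNPP => nex.
have Fz p2 : restr p2 F = 0.
  apply: (poly0_of_infinite K_infinite) => p1; apply/eqP/negPn/negP => nz.
  by apply: nex; exists p1, p2.
case/eqP: F0; apply/polyP=> i; rewrite coef0; apply: (poly0_of_infinite K_infinite) => p2.
by have /polyP/(_ i) := Fz p2; rewrite coef_map coef0.
Qed.

End TotalDegree.

Lemma coefM_top (R : nzRingType) m n (p q : {poly R}) :
  (size p <= m.+1)%N -> (size q <= n.+1)%N -> (p * q)`_(m + n) = p`_m * q`_n.
Proof.
move=> pm qn; rewrite coefM (bigD1 (inord m)) //= inordK ?leq_addr // ?ltnS ?leq_addr //.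
rewrite addKn big1 ?addr0 // => i im.
have [mi|] := ltnP m i; first by rewrite nth_default ?mul0r // (leq_trans pm).
rewrite leq_eqVlt => /orP[/eqP iE|im'].
  by case/eqP: im; apply: val_inj; rewrite /= inordK ?ltnS ?leq_addr.
rewrite [q`__]nth_default ?mulr0 // (leq_trans qn) //; lia.
Qed.

Section Leading.
Variable K : fieldType.
Local Notation P2 := {poly {poly K}}.

Lemma coef_top_mul m n (G Q : P2) : tdeg_le m G -> tdeg_le n Q ->
  (G * Q)`_(m + n)`_0 = G`_m`_0 * Q`_n`_0.
Proof.
move=> Gm Qn.
have R (F : P2) k : F`_k`_0 = (restr 0 F)`_k by rewrite coef_map /= /horner_eval horner_coef0.
rewrite !R -(coefM_top (size_restr 0 Gm) (size_restr 0 Qn)).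
by rewrite /restr rmorphM.
Qed.

(** The degree m part of [G] contains x^m, so it is not a divisor of y^(m+n), the
    top degree part of the left-hand side: at y = 1 it is a nonconstant
    polynomial in x. *)
Lemma top_form_not_unit m n (G Q P : P2) : (0 < m)%N -> G`_m`_0 != 0 ->
    tdeg_le m G -> tdeg_le n Q -> tdeg_le (m + n).-1 P ->
  bimono 1 0 (m + n) - P <> G * Q.
Proof.
move=> m0 Gm0 Gm Qn Pd E.
have GQ1 : (bigrade G)`_m * (bigrade Q)`_n = 1.
  rewrite -coefM_top; try exact/tdeg_leP.
  rewrite -bigradeM -E; apply/polyP=> i; rewrite coef_bigrade !coefB coef_bimono.
  case: leqP => imn; last by rewrite coef1 gtn_eqF // (leq_trans _ imn).
  rewrite Pd ?subr0 ?mul1r ?coef1; last by rewrite subnKC // prednK // addn_gt0 m0.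
  by case: eqVneq => // ->; rewrite subn0 eqxx.
have : (bigrade G)`_m %| 1 by rewrite -GQ1 dvdp_mulr.
rewrite dvdp1 => /eqP s1.
have : (bigrade G)`_m`_m = 0 by rewrite nth_default // s1.
by rewrite coef_bigrade leqnn subnn => /eqP; rewrite (negbTE Gm0).
Qed.

End Leading.

(** * Forms of degree d and bivariate polynomials of total degree at most d *)

Section Homogenization.
Variable K : fieldType.
Local Notation P2 := {poly {poly K}}.
Local Notation R := {mpoly K[3]}.
Variables X Y Z : R.

(** z^d F(x/z, y/z) at x = X, y = Y, z = Z, for [F] of total degree at most [d];
    the truncated exponent matters only outside this range. *)
Definition homogenize (d : nat) (F : P2) : R :=
  \sum_(i < d.+1) \sum_(l < d.+1)
    F`_i`_l *: (X ^+ i * Y ^+ l * Z ^+ (d - (i + l))).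

Lemma homogenize0 d : homogenize d 0 = 0.
Proof.
rewrite /homogenize big1 // => i _; rewrite big1 // => l _.
by rewrite !coef0 scale0r.
Qed.

Lemma homogenizeD d F G : homogenize d (F + G) = homogenize d F + homogenize d G.
Proof.
rewrite /homogenize -big_split /=; apply: eq_bigr => i _.
by rewrite -big_split; apply: eq_bigr => l _; rewrite !coefD scalerDl.
Qed.

Lemma homogenizeN d F : homogenize d (- F) = - homogenize d F.
Proof. by apply/eqP; rewrite -subr_eq0 opprK -homogenizeD addNr homogenize0. Qed.

Lemma homogenizeB d F G : homogenize d (F - G) = homogenize d F - homogenize d G.
Proof. by rewrite homogenizeD homogenizeN. Qed.

Lemma homogenize_bimono d c i l : (i + l <= d)%N ->
  homogenize d (bimono c i l) = c *: (X ^+ i * Y ^+ l * Z ^+ (d - (i + l))).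
Proof.
move=> ild.
have id1 : (i < d.+1)%N by rewrite ltnS (leq_trans _ ild) ?leq_addr.
have ld1 : (l < d.+1)%N by rewrite ltnS (leq_trans _ ild) ?leq_addl.
rewrite /homogenize (bigD1 (Ordinal id1)) //= (bigD1 (Ordinal ld1)) //=.
rewrite coef_bimono !eqxx mulr1 !big1 ?addr0 // => [i'|l'].
  rewrite -val_eqE /= => /negbTE ii; rewrite big1 // => l' _.
  by rewrite coef_bimono ii mulr0 scale0r.
by rewrite -val_eqE /= coef_bimono => /negbTE ->; rewrite andbF mulr0 scale0r.
Qed.

Lemma homogenizeM d e F G : tdeg_le d F -> tdeg_le e G ->
  homogenize (d + e) (F * G) = homogenize d F * homogenize e G.
Proof.
move=> Fd; move: G.
apply: tdeg_le_ind => [|G G'|c' i' l' il'e].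
- by rewrite mulr0 !homogenize0 mulr0.
- by rewrite mulrDr !homogenizeD mulrDr => -> ->.
elim/tdeg_le_ind: F / Fd => [|F F'|c i l ild].
- by rewrite mul0r !homogenize0 mul0r.
- by rewrite mulrDl !homogenizeD mulrDl => -> ->.
rewrite bimonoM !homogenize_bimono //; last by rewrite addnACA leq_add.
rewrite -scalerAl -scalerAr scalerA; congr (_ *: _).
have -> : (d + e - (i + i' + (l + l')) = (d - (i + l)) + (e - (i' + l')))%N by lia.
rewrite !exprD; ring.
Qed.

Lemma homogenizeXn d F n : tdeg_le d F ->
  tdeg_le (d * n) (F ^+ n) /\ homogenize (d * n) (F ^+ n) = homogenize d F ^+ n.
Proof.
move=> Fd; elim: n => [|n [IH1 IH2]].
  rewrite muln0 !expr0 (_ : 1 = bimono 1 0 0); last by rewrite /bimono !expr0 alg_polyC scale1r.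
  by split; [apply: tdeg_le_bimono | rewrite homogenize_bimono // !expr0 !mul1r scale1r].
rewrite mulnS !exprS homogenizeM // IH2; split=> //; exact: tdeg_leM.
Qed.

Lemma homogenizeZ d c F : tdeg_le d F ->
  homogenize d (bimono c 0 0 * F) = c *: homogenize d F.
Proof.
move=> Fd; rewrite -{1}[d]add0n homogenizeM //; last exact: tdeg_le_bimono.
by rewrite homogenize_bimono // !expr0 !mulr1 -scalerAl mul1r.
Qed.

Hypothesis X1 : X \is 1.-homog.
Hypothesis Y1 : Y \is 1.-homog.
Hypothesis Z1 : Z \is 1.-homog.

Lemma homogenize_dhomog d F : tdeg_le d F -> homogenize d F \is d.-homog.
Proof.
elim/tdeg_le_ind: F / => [|F G Fd Gd|c i l ild].
- by rewrite homogenize0 dhomog0.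
- by rewrite homogenizeD rpredD.
rewrite homogenize_bimono // rpredZ //.
have := dhomogM (dhomogM (dhomogMn i X1) (dhomogMn l Y1)) (dhomogMn (d - (i + l)) Z1).
by rewrite !mul1n subnKC.
Qed.

Variable v : 'I_3 -> P2.
Hypothesis v1 : forall i, tdeg_le 1 (v i).
Hypothesis vE : forall i, 'X_i = homogenize 1 (v i).

Lemma homogenize_surj d f : f \is d.-homog ->
  exists2 F, tdeg_le d F & f = homogenize d F.
Proof.
move=> fd; rewrite [f]mpolyE big_seq.
elim/big_rec: _ => [|m f' mf [F Fd ->]].
  by exists 0; [move=> i l _; rewrite !coef0 | rewrite homogenize0].
have [G Gm ->] : exists2 G, tdeg_le (mdeg m) G & 'X_[m] = homogenize (mdeg m) G.
  rewrite mpolyXE_id mdegE.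
  elim/big_rec2: _ => [|i e f'' _ [G Ge ->]].
    exists (bimono 1 0 0); first exact: tdeg_le_bimono.
    by rewrite homogenize_bimono // !expr0 !mul1r scale1r.
  have [] := homogenizeXn (m i) (v1 i); rewrite mul1n => vid vih.
  exists (v i ^+ m i * G); first exact: tdeg_leM.
  by rewrite homogenizeM // vE vih.
have md : mdeg m = d by apply: (dhomog_mf fd).
rewrite md in Gm *.
exists (bimono f@_m 0 0 * G + F); last by rewrite homogenizeD homogenizeZ.
by apply: tdeg_leD => //; rewrite -[d]add0n; apply: tdeg_leM => //; apply: tdeg_le_bimono.
Qed.

End Homogenization.

Section Evaluation.
Variables (K : fieldType) (X Y Z : {mpoly K[3]}) (w : 'I_3 -> K).

Lemma meval_homogenize_affine d F : Z.@[w] = 1 -> tdeg_le d F ->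
  (homogenize X Y Z d F).@[w] = (restr Y.@[w] F).[X.@[w]].
Proof.
move=> Zw; elim/tdeg_le_ind: F / => [|F G|c i l il].
- by rewrite homogenize0 meval0 /restr rmorph0 horner0.
- by rewrite homogenizeD mevalD /restr rmorphD hornerD => -> ->.
rewrite homogenize_bimono // mevalZ !mevalM !rmorphXn /= Zw expr1n mulr1.
rewrite /restr /bimono map_polyZ /= map_polyXn /horner_eval !hornerE.
by rewrite -[LHS]/(c * X.@[w] ^+ i * Y.@[w] ^+ l) mulrAC.
Qed.

Lemma meval_homogenize_top d F : X.@[w] = 1 -> Y.@[w] = 0 -> Z.@[w] = 0 ->
  tdeg_le d F -> (homogenize X Y Z d F).@[w] = F`_d`_0.
Proof.
move=> Xw Yw Zw; elim/tdeg_le_ind: F / => [|F G|c i l il].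
- by rewrite homogenize0 meval0 !coef0.
- by rewrite homogenizeD mevalD !coefD => -> ->.
rewrite homogenize_bimono // mevalZ !mevalM !rmorphXn /= Xw Yw Zw expr1n mul1r coef_bimono.
congr (_ * _); rewrite !expr0n -natrM mulnb; congr ((nat_of_bool _)%:R).
by apply/andP/andP => -[/eqP ? /eqP ?]; split; apply/eqP; lia.
Qed.

End Evaluation.

(** * Graded quotients and socle duality *)

Section GradedQuotient.
Variables (K : fieldType) (A : gradedArtinianQuotient K).
Local Notation pi := (quot_proj A).
Local Notation A_ i := (gpart A i).
Local Notation "w ** U" := (amull w @: U)%VS (at level 40).

Lemma quot_mulC (a b : A) : a * b = b * a.
Proof.
have [f <-] := quot_proj_surj a; have [g <-] := quot_proj_surj b.
by rewrite -!rmorphM mulrC.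
Qed.

Lemma quot_mulCA (a b c : A) : a * (b * c) = b * (a * c).
Proof. by rewrite !mulrA (quot_mulC a). Qed.

Lemma gpart_homog f i : f \is i.-homog -> pi f \in A_ i.
Proof. by move=> fi; apply/mem_gpart; exists f. Qed.

Lemma gpartM a b i j : a \in A_ i -> b \in A_ j -> a * b \in A_ (i + j).
Proof.
move=> /mem_gpart[f fi ->] /mem_gpart[g gj ->].
by rewrite -rmorphM gpart_homog // dhomogM.
Qed.

Lemma gpart1 : 1 \in A_ 0.
Proof. by rewrite -(rmorph1 pi) gpart_homog ?dhomog1. Qed.

Lemma gpartXn a i n : a \in A_ i -> a ^+ n \in A_ (i * n).
Proof.
move=> ai; elim: n => [|n IHn]; first by rewrite muln0 expr0 gpart1.
by rewrite mulnS exprS gpartM.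
Qed.

Lemma gpart_var l : pi 'X_l \in A_ 1.
Proof. by rewrite gpart_homog // dhomogX /= mdeg1. Qed.

Lemma gpart_cap i j a : i != j -> a \in A_ i -> a \in A_ j -> a = 0.
Proof.
move=> ij /mem_gpart[f fi aE] /mem_gpart[g gj]; rewrite {1}aE => fg.
have : pi (pihomog mdeg i (f - g)) = 0.
  by apply: quot_ker_homog; rewrite raddfB /= fg subrr.
rewrite pihomogB pihomog_dE // (pihomog_ne0 _ gj) 1?eq_sym // subr0.
by rewrite aE.
Qed.

(** A is generated in degree 1. *)
Lemma gpartS_sub i (W : {vspace A}) :
    (forall l u, u \in A_ i -> pi 'X_l * u \in W) ->
  (A_ i.+1 <= W)%VS.
Proof.
move=> XW; apply/subvP => a /mem_gpart[f fi ->].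
rewrite [f]mpolyE big_seq raddf_sum /=; apply: memv_suml => m mf.
rewrite linearZ /= memvZ //.
have md : mdeg m = i.+1 by apply: (dhomog_mf fi).
have [l ml] : exists l, m l != 0%N.
  have [l ml|m0] := pickP (fun l => m l != 0%N); first by exists l.
  by move: md; rewrite mdegE big1 // => l _; apply/eqP; have /negbFE := m0 l.
have mE : m = (U_(l) + (m - U_(l)))%MM by rewrite addmC submK // lep1mP.
rewrite mE mpolyXD rmorphM /=; apply: XW; apply: gpart_homog.
by rewrite dhomogX /=; move: md; rewrite {1}mE mdegD mdeg1 add1n => -[->].
Qed.

Lemma memv_amull (w a : A) (U : {vspace A}) :
  reflect (exists2 u, u \in U & a = w * u) (a \in (w ** U)%VS).
Proof. by apply: (iffP memv_imgP) => -[u uU ->]; exists u; rewrite ?lfunE. Qed.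

Lemma amull_in (w u : A) (U : {vspace A}) : u \in U -> w * u \in (w ** U)%VS.
Proof. by move=> uU; apply/memv_amull; exists u. Qed.

Lemma amull_mul (w w' : A) (U : {vspace A}) :
  ((w * w') ** U)%VS = (amull w @: (amull w' @: U))%VS.
Proof.
rewrite -limg_comp; apply: eq_in_limg => u _.
by rewrite comp_lfunE !lfunE /= mulrA.
Qed.

Lemma amull_comm (w w' : A) (U : {vspace A}) :
  (w ** (w' ** U) = w' ** (w ** U))%VS.
Proof. by rewrite -!amull_mul quot_mulC. Qed.

Lemma amull_gpart_sub (w : A) d i : w \in A_ d ->
  (w ** A_ i <= A_ (d + i))%VS.
Proof. by move=> wd; apply/subvP => a /memv_amull[u ui ->]; apply: gpartM. Qed.

Section SocleDuality.
Variable j : nat.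
Hypothesis A_gor : gorenstein A.
Hypothesis dim_top : \dim (A_ j) = 1%N.
Hypothesis dim_above : forall i, (j < i)%N -> \dim (A_ i) = 0%N.

Lemma gpart_above i a : (j < i)%N -> a \in A_ i -> a = 0.
Proof.
by move=> /dim_above/eqP; rewrite dimv_eq0 => /eqP ->; rewrite memv0 => /eqP.
Qed.

Lemma mem_gsocle_var a : (forall l, pi 'X_l * a = 0) -> a \in gsocle A.
Proof.
move=> Xa; rewrite memvE; apply/subv_bigcapP => l _.
by rewrite -memvE memv_ker lfunE /= Xa.
Qed.

Lemma gsocleE : gsocle A = A_ j.
Proof.
apply/esym/eqP; rewrite -dimv_leqif_eq ?A_gor ?dim_top //.
apply/subvP => a aj; apply: mem_gsocle_var => l.
by apply: (@gpart_above j.+1) => //; apply: (@gpartM _ _ 1 j) => //; apply: gpart_var.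
Qed.

(** A nonzero element of degree < j is outside the socle, so some variable
    multiplies it to a nonzero element of the next degree. *)
Lemma socle_pairing i u : (i <= j)%N -> u \in A_ i ->
  (forall v, v \in A_ (j - i) -> u * v = 0) -> u = 0.
Proof.
move=> ij; move: {2}(j - i)%N (erefl (j - i)%N) => n.
elim: n i u ij => [|n IHn] i u ij jin ui uv0.
  by rewrite -(mulr1 u) uv0 // jin gpart1.
have ij' : (i < j)%N by lia.
apply: (@gpart_cap i j) => //; first by rewrite ltn_eqF.
rewrite -gsocleE; apply: mem_gsocle_var => l.
apply: (IHn i.+1) => //; first lia.
  by apply: (@gpartM _ _ 1 i) => //; apply: gpart_var.
move=> v vj; rewrite [_ * u]quot_mulC -mulrA; apply: uv0.
have -> : (j - i = 1 + (j - i.+1))%N by lia.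
by apply: gpartM => //; apply: gpart_var.
Qed.

(** [U] embeds in the dual of [V]: an element of [U] is determined by the
    coordinates in the line A_j of its products with a basis of [V]. *)
Lemma dim_le_pairing (U V : {vspace A}) :
    (forall u v, u \in U -> v \in V -> u * v \in A_ j) ->
    (forall u, u \in U -> (forall v, v \in V -> u * v = 0) -> u = 0) ->
  (\dim U <= \dim V)%N.
Proof.
move=> UVj nondeg.
pose f (u : A) : 'rV[K]_(\dim V) := \row_q coord (vbasis (A_ j))
   (cast_ord (esym dim_top) ord0) (u * (vbasis V)`_q).
have f_lin : linear f.
  move=> c u v; apply/rowP => q; rewrite !mxE mulrDl -scalerAl.
  by rewrite linearP.
pose F := GRing.isLinear.Build _ _ _ _ _ f_lin.
pose fl : {linear A -> 'rV[K]_(\dim V)} := HB.pack f F.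
have fE u : linfun fl u = f u by rewrite lfunE.
have -> : \dim U = \dim (linfun fl @: U).
  apply/esym/limg_dim_eq/eqP; rewrite -subv0; apply/subvP => u.
  rewrite memv_cap memv_ker fE memv0 => /andP[uU /eqP fu0]; apply/eqP.
  apply: nondeg => // v vV; rewrite (coord_vbasis vV) mulr_sumr big1 // => q _.
  rewrite -scalerAr.
  have bq : (vbasis V)`_q \in V by rewrite vbasis_mem // mem_nth // size_tuple.
  rewrite (coord_vbasis (UVj _ _ uU bq)) big1 ?scaler0 // => k _.
  have -> : k = cast_ord (esym dim_top) ord0.
    apply: val_inj => /=; have := ltn_ord k; rewrite {2}dim_top.
    by case: (nat_of_ord k).
  by have /rowP/(_ q) := fu0; rewrite !mxE => ->; rewrite scale0r.
by apply: leq_trans (dimvS (subvf _)) _; rewrite dimvf /dim /= mul1n.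
Qed.

(** For u in A_i and v in A_(j-d-i) the product w u v depends only on w u and on
    w v, so it pairs w A_i with w A_(j-d-i); the pairing is nondegenerate on
    both sides by [socle_pairing].  Below, [V] is a complement of the kernel of
    [w], on which multiplication by [w] is injective. *)
Lemma rank_duality (w : A) d i : w \in A_ d -> (d + i <= j)%N ->
  \dim (w ** A_ i) = \dim (w ** A_ (j - (d + i))).
Proof.
move=> wd dij.
have half i1 i2 : (d + i1 + i2 = j)%N ->
    (\dim (w ** A_ i1) <= \dim (w ** A_ i2))%N.
  move=> dii; set V := (A_ i2 :\: lker (amull w))%VS.
  have <- : \dim V = \dim (w ** A_ i2).
    by rewrite -limg_ker_compl limg_dim_eq ?capv_diff.
  apply: dim_le_pairing => [a v /memv_amull[u ui ->] vV | a /memv_amull[u ui ->] av0].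
    rewrite -dii; apply: gpartM; first exact: gpartM.
    exact: subvP (diffvSl _ _) _ vV.
  apply: (@socle_pairing (d + i1)); [lia | exact: gpartM | move=> v vi].
  have : w * v \in (w ** V)%VS.
    rewrite limg_ker_compl; apply: amull_in.
    by move: vi; rewrite (_ : j - (d + i1) = i2)%N //; lia.
  case/memv_amull=> v' v'V wv.
  by rewrite [w * u]quot_mulC -mulrA wv mulrA [u * w]quot_mulC av0.
by apply/eqP; rewrite eqn_leq !half //; lia.
Qed.

End SocleDuality.

(** Above degree [n], multiplication by [w] maps each graded piece of gA/ghA onto
    the next, because gA is generated by [h] and [w] there; so the dimension of
    these pieces does not increase.  It is stated with sums, each side carrying
    the dimension subtracted on the other. *)
Lemma rank_defect_mono (g h w : A) (n : nat) :
    (forall m, (n < m)%N -> (g ** A_ m.+1 <= (g * h) ** A_ m + (g * w) ** A_ m)%VS) ->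
    h \in A_ 1 -> w \in A_ 1 ->
  forall k, (\dim (g ** A_ (n + k).+1) + \dim ((g * h) ** A_ n) <=
             \dim (g ** A_ n.+1) + \dim ((g * h) ** A_ (n + k)))%N.
Proof.
move=> gen h1 w1; elim=> [|k IHk]; first by rewrite !addn0.
set m := (n + k)%N in IHk *; rewrite addnS -/m.
have D := dim_preim_add (amull w) (g ** A_ m.+1) ((g * h) ** A_ m.+1).
have s1 : (\dim (g ** A_ m.+2) <= \dim (w ** (g ** A_ m.+1) + (g * h) ** A_ m.+1))%N.
  apply/dimvS/(subv_trans (gen m.+1 _)); first by rewrite ltnS leq_addr.
  by rewrite addvC amull_mul amull_comm addvS // subvv.
have s2 : (\dim ((g * h) ** A_ m) <=
    \dim ((g ** A_ m.+1) :&: amull w @^-1: ((g * h) ** A_ m.+1)))%N.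
  apply/dimvS/subvP => a /memv_amull[u um ->].
  rewrite memv_cap -memv_preim lfunE /=; apply/andP; split.
    by rewrite -mulrA amull_in //; apply: (@gpartM _ _ 1 m).
  by rewrite quot_mulCA amull_in //; apply: (@gpartM _ _ 1 m).
lia.
Qed.

End GradedQuotient.

(** * Coordinates *)

Section Coordinates.
Variables (K : fieldType) (A : gradedArtinianQuotient K).
Variables (p1 p2 : K).
Local Notation P2 := {poly {poly K}}.
Local Notation pi := (quot_proj A).
Local Notation A_ i := (gpart A i).
Local Notation "w ** U" := (amull w @: U)%VS (at level 40).

Let X : {mpoly K[3]} := mpolyX K U_(0%R).
Let Y : {mpoly K[3]} := mpolyX K U_(1%R) - p1 *: X.
Let Z : {mpoly K[3]} := mpolyX K U_(2%R) - p2 *: X.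
Let x := pi X.
Let y := pi Y.
Let z := pi Z.

(** The value in [A] of the form of degree [d] given by [F] in the coordinates
    X, Y, Z, which vanish, except for X, at the point (1 : p1 : p2). *)
Definition ev (d : nat) (F : P2) : A := pi (homogenize X Y Z d F).

Let X1 : X \is 1.-homog. Proof. by rewrite dhomogX /= mdeg1. Qed.
Let Y1 : Y \is 1.-homog. Proof. by rewrite rpredB ?rpredZ // dhomogX /= mdeg1. Qed.
Let Z1 : Z \is 1.-homog. Proof. by rewrite rpredB ?rpredZ // dhomogX /= mdeg1. Qed.
Let x1 : x \in A_ 1. Proof. exact: gpart_homog. Qed.
Let y1 : y \in A_ 1. Proof. exact: gpart_homog. Qed.
Let z1 : z \in A_ 1. Proof. exact: gpart_homog. Qed.

Lemma evD d F G : ev d (F + G) = ev d F + ev d G.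
Proof. by rewrite /ev homogenizeD raddfD. Qed.

Lemma evB d F G : ev d (F - G) = ev d F - ev d G.
Proof. by rewrite /ev homogenizeB raddfB. Qed.

Lemma ev0 d : ev d 0 = 0.
Proof. by rewrite /ev homogenize0 raddf0. Qed.

Lemma evM d e F G : tdeg_le d F -> tdeg_le e G ->
  ev (d + e) (F * G) = ev d F * ev e G.
Proof. by move=> Fd Ge; rewrite /ev homogenizeM // rmorphM. Qed.

Lemma ev_bimono d c i l : (i + l <= d)%N ->
  ev d (bimono c i l) = c *: (x ^+ i * y ^+ l * z ^+ (d - (i + l))).
Proof. by move=> ild; rewrite /ev homogenize_bimono // linearZ /= !rmorphM !rmorphXn. Qed.

Lemma evZ d c F : tdeg_le d F -> ev d (bimono c 0 0 * F) = c *: ev d F.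
Proof. by move=> Fd; rewrite /ev homogenizeZ // linearZ. Qed.

Lemma ev_gpart d F : tdeg_le d F -> ev d F \in A_ d.
Proof. by move=> Fd; apply: gpart_homog; apply: homogenize_dhomog. Qed.

Lemma coordinate_form d f : f \is d.-homog ->
  exists2 F, tdeg_le d F & f = homogenize X Y Z d F.
Proof.
pose v (l : 'I_3) : P2 := nth 0 [:: bimono 1 1 0; bimono 1 0 1 + bimono p1 1 0;
   bimono 1 0 0 + bimono p2 1 0] l.
apply: (@homogenize_surj K X Y Z v).
  by move=> [[|[|[|l]]] lt] //; rewrite /v /=; do ?apply: tdeg_leD; apply: tdeg_le_bimono.
have XE (l l' : 'I_3) : l = l' :> nat -> mpolyX K U_(l) = mpolyX K U_(l').
  by move=> /val_inj ->.
move=> [[|[|[|l]]] lt] //; rewrite /v /= ?homogenizeD !homogenize_bimono //=;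
  rewrite ?subn0 ?subnn !expr0 !expr1 !scale1r ?mul1r ?mulr1.
- exact: XE.
- by rewrite subrK; apply: XE.
- by rewrite subrK; apply: XE.
Qed.

Lemma ev_surj d u : u \in A_ d -> exists2 F, tdeg_le d F & u = ev d F.
Proof. by move=> /mem_gpart[f /coordinate_form[F Fd ->] ->]; exists F. Qed.

Lemma ev_z d F : tdeg_le d F -> z * ev d F = ev d.+1 F.
Proof.
move=> Fd; rewrite -add1n -{2}(mul1r F) (_ : 1 = bimono 1 0 0); last first.
  by rewrite /bimono !expr0 alg_polyC scale1r.
by rewrite evM ?ev_bimono ?expr0 ?scale1r ?mul1r //; apply: tdeg_le_bimono.
Qed.

Lemma ev_x d F : tdeg_le d F -> x * ev d F = ev d.+1 (bimono 1 1 0 * F).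
Proof.
move=> Fd; rewrite -add1n evM ?ev_bimono ?addn0 ?subnn ?expr0 ?scale1r ?mulr1 ?expr1 //.
exact: tdeg_le_bimono.
Qed.

Lemma ev_yz d c F : tdeg_le d F ->
  (y - c *: z) * ev d F = ev d.+1 ((bimono 1 0 1 - bimono c 0 0) * F).
Proof.
move=> Fd; rewrite -add1n evM //; last by apply: tdeg_leB; apply: tdeg_le_bimono.
by rewrite evB !ev_bimono // ?add0n subnn subn0 !expr0 !mul1r mulr1 scale1r.
Qed.

Lemma monomial_gpart i l k m : (i + l + k = m)%N ->
  x ^+ i * y ^+ l * z ^+ k \in A_ m.
Proof.
by move=> <-; rewrite !gpartM //;
  [rewrite -[X in A_ X](mul1n i) | rewrite -[X in A_ X](mul1n l)
  | rewrite -[X in A_ X](mul1n k)]; apply: gpartXn.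
Qed.

(** The only monomial of degree m + 1 not divisible by y or z is x^(m+1). *)
Lemma gpart_sub_pow m (W : {vspace A}) : x ^+ m.+1 \in W ->
    (forall u, u \in A_ m -> y * u \in W) ->
    (forall u, u \in A_ m -> z * u \in W) ->
  (A_ m.+1 <= W)%VS.
Proof.
move=> xW yW zW; apply/subvP => a /ev_surj[F Fm ->].
elim/tdeg_le_ind: F / Fm => [|F G|c i l ilm].
- by rewrite ev0 mem0v.
- by rewrite evD; apply: memvD.
rewrite ev_bimono // memvZ //.
case: l ilm => [|l] ilm.
  rewrite expr0 mulr1 addn0; have [im|mi] := leqP i m.
    have -> : (m.+1 - i = (m - i).+1)%N by lia.
    rewrite exprS quot_mulCA; apply: zW.
    by rewrite -[x ^+ i]mulr1 -(expr0 y) monomial_gpart // addn0 subnKC.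
  have -> : i = m.+1 by move: ilm; lia.
  by rewrite subnn expr0 mulr1.
rewrite exprS -!mulrA quot_mulCA; apply: yW.
by rewrite mulrA monomial_gpart //; lia.
Qed.


Lemma gpart_top_coef n F : tdeg_le n.+1 F ->
  ev n.+1 F - F`_n.+1`_0 *: x ^+ n.+1 \in (y ** A_ n + z ** A_ n)%VS.
Proof.
elim/tdeg_le_ind: F / => [|F G|c i l il].
- by rewrite ev0 !coef0 scale0r subrr mem0v.
- move=> Fm Gm; rewrite evD !coefD scalerDl opprD addrACA; exact: memvD.
rewrite ev_bimono // coef_bimono.
case: l il => [|l] il; last first.
  rewrite andbF mulr0 scale0r subr0 memvZ // (subvP (addvSl _ _)) //.
  rewrite exprS -!mulrA quot_mulCA amull_in // mulrA monomial_gpart //; move: il; lia.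
have [<-|im] := eqVneq n.+1 i.
  by rewrite addn0 subnn !expr0 !mulr1 subrr mem0v.
rewrite mulr0 scale0r subr0 memvZ // (subvP (addvSr _ _)) //.
have -> : (n.+1 - (i + 0) = (n - i).+1)%N by move: il im; lia.
by rewrite exprS quot_mulCA amull_in // monomial_gpart //; move: il im; lia.
Qed.

(** A relation g Q(x, y, z) = 0 involving x^(n+1) expresses g x^(n+1) by multiples
    of g y and g z; multiplying by x propagates this to higher degrees. *)
Lemma top_power_mem (g : A) n Q : tdeg_le n.+1 Q -> g * ev n.+1 Q = 0 ->
    Q`_n.+1`_0 != 0 ->
  forall m, (n <= m)%N -> (g ** A_ m.+1 <= (g * y) ** A_ m + (g * z) ** A_ m)%VS.
Proof.
move=> Qn gQ Q0.
have base : g * x ^+ n.+1 \in ((g * y) ** A_ n + (g * z) ** A_ n)%VS.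
  have := gpart_top_coef Qn; rewrite -memvN opprB => H.
  have := amull_in g H; rewrite limgD -!amull_mul mulrBr gQ subr0 -scalerAr.
  by move/(memvZ (Q`_n.+1`_0)^-1); rewrite scalerA mulVf // scale1r.
move=> m nm.
have xm : g * x ^+ m.+1 \in ((g * y) ** A_ m + (g * z) ** A_ m)%VS.
  have -> : x ^+ m.+1 = x ^+ (m - n) * x ^+ n.+1 by rewrite -exprD addnS subnK.
  rewrite quot_mulCA.
  have := amull_in (x ^+ (m - n)) base; rewrite limgD.
  have xsub : (x ^+ (m - n) ** A_ n <= A_ m)%VS.
    rewrite -{2}(subnK nm) amull_gpart_sub //.
    by rewrite -[X in A_ X]mul1n gpartXn.
  by apply/subvP/addvS; rewrite amull_comm limgS.
set W := (_ + _)%VS in xm *.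
have : (A_ m.+1 <= amull g @^-1: W)%VS.
  apply: gpart_sub_pow; first by rewrite -memv_preim lfunE.
    move=> u um; rewrite -memv_preim lfunE /= mulrA.
    by rewrite (subvP (addvSl _ _)) // amull_in.
  move=> u um; rewrite -memv_preim lfunE /= mulrA.
  by rewrite (subvP (addvSr _ _)) // amull_in.
move=> sub; apply/subvP => v /memv_amull[u /(subvP sub)].
by rewrite -memv_preim lfunE /= => uW ->.
Qed.

(** * The pencil of linear forms y - c z *)

Section Core.
Variables (j a b s : nat).
Hypothesis K_infinite : forall e : seq K, exists c : K, c \notin e.
Hypothesis A_gor : gorenstein A.
Hypothesis dim_top : \dim (A_ j) = 1%N.
Hypothesis dim_above : forall i, (j < i)%N -> \dim (A_ i) = 0%N.
Hypothesis abj : (a + b = j)%N.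
Hypothesis ab2 : (a + 2 <= b)%N.
Hypothesis dim_s : forall i, (a <= i <= b)%N -> \dim (A_ i) = s.
Variable F0 : P2.
Hypothesis F0d : tdeg_le a.+1 F0.
Hypothesis F0z : ev a.+1 F0 = 0.
Hypothesis F0t : F0`_a.+1`_0 != 0.

Let h (c : K) : A := y - c *: z.
Let h1 c : h c \in A_ 1. Proof. by rewrite memvB // memvZ. Qed.

Lemma pencil_gen c m : (a <= m)%N -> (A_ m.+1 <= h c ** A_ m + z ** A_ m)%VS.
Proof.
move=> am.
have := @top_power_mem 1 a F0 F0d _ F0t m am; rewrite !mul1r amull1 lim1g => /(_ F0z).
move=> sub; apply: (subv_trans sub); rewrite subv_add addvSr andbT.
apply/subvP => v /memv_amull[u um ->].
have -> : y * u = h c * u + z * (c *: u).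
  by rewrite /h mulrBl -scalerAr -scalerAl subrK.
by rewrite memv_add // amull_in // memvZ.
Qed.

(** In degrees a+1, ..., b the dimension of A/hA is nonincreasing and takes equal
    values at the ends, so it is constant and [z], which is onto, is
    bijective. *)
Lemma pencil_quotient_inj c u : u \in A_ a.+1 -> z * u \in (h c ** A_ a.+1)%VS ->
  u \in (h c ** A_ a)%VS.
Proof.
have r_mono n : (a <= n)%N -> forall k, (n + k.+1 <= b)%N ->
    (\dim (h c ** A_ n) <= \dim (h c ** A_ (n + k)))%N.
  move=> an k nkb.
  have gen m : (n < m)%N -> ((1 : A) ** A_ m.+1 <= (1 * h c) ** A_ m + (1 * z) ** A_ m)%VS.
    by move=> nm; rewrite amull1 lim1g !mul1r pencil_gen //; lia.
  have := rank_defect_mono gen (h1 c) z1 k.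
  by rewrite amull1 !lim1g mul1r !dim_s ?leq_add2l //; lia.
have dual : \dim (h c ** A_ a) = \dim (h c ** A_ b.-1).
  rewrite (rank_duality A_gor dim_top dim_above (h1 c)); last lia.
  by congr (\dim (_ ** A_ _)); lia.
have r_eq : \dim (h c ** A_ a.+1) = \dim (h c ** A_ a).
  apply/eqP; rewrite eqn_leq; apply/andP; split.
    have := r_mono a.+1 (leqnSn _) (b - a.+2)%N.
    by rewrite dual (_ : a.+1 + (b - a.+2) = b.-1)%N; [apply; lia | lia].
  by have := r_mono a (leqnn _) 1%N; rewrite addn1; apply; lia.
have D := dim_preim_add (amull z) (A_ a.+1) (h c ** A_ a.+1).
have sE : (z ** A_ a.+1 + h c ** A_ a.+1)%VS = A_ a.+2.
  apply/eqP; rewrite eqEsubv addvC pencil_gen // andbT subv_add.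
  by rewrite !(@amull_gpart_sub _ _ _ 1).
rewrite sE !dim_s in D; try lia.
have sub : (h c ** A_ a <= A_ a.+1 :&: amull z @^-1: (h c ** A_ a.+1))%VS.
  apply/subvP => v /memv_amull[t ta ->].
  rewrite memv_cap -memv_preim lfunE /=; apply/andP; split; first exact: (@gpartM _ _ _ _ 1 a).
  by rewrite quot_mulCA amull_in //; apply: (@gpartM _ _ _ _ 1 a).
have subE : (A_ a.+1 :&: amull z @^-1: (h c ** A_ a.+1) <= h c ** A_ a)%VS.
  by rewrite -(dimv_leqif_sup sub); apply/eqP; move: D r_eq; lia.
move=> ua zu; apply: (subvP subE).
by rewrite memv_cap ua -memv_preim lfunE.
Qed.

(** The polynomials in [x] that vanish in A/hA after homogenization by [z] to
    degree a+1 form a truncated ideal: if P vanishes and x P still has degree at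
    most a+1, then x P homogenized to degree a+2 is z times x P homogenized to
    degree a+1, and [pencil_quotient_inj] cancels [z].  Its generator is not
    constant, since otherwise A/hA would vanish in degree a+1. *)
Lemma pencil_common_divisor c : ~ (A_ a.+1 <= h c ** A_ a)%VS ->
  exists2 chi : {poly K}, (1 < size chi)%N &
    forall F, tdeg_le a.+1 F -> ev a.+1 F = 0 -> chi %| restr c F.
Proof.
move=> nsurj.
pose V (P : {poly K}) :=
  (size P <= a.+2)%N /\ ev a.+1 (map_poly polyC P) \in (h c ** A_ a)%VS.
have Vrestr F : tdeg_le a.+1 F -> ev a.+1 F \in (h c ** A_ a)%VS <-> V (restr c F).
  move=> Fd; have [Q Qd FE] := restr_decomp c Fd.
  have sF := size_restr c Fd.
  have -> : ev a.+1 F = ev a.+1 (map_poly polyC (restr c F)) + h c * ev a Q.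
    by rewrite {1}FE evD ev_yz.
  have hQ : h c * ev a Q \in (h c ** A_ a)%VS by rewrite amull_in ?ev_gpart.
  by split=> [|[_]]; [rewrite rpredDr // | rewrite rpredDr].
have [chi chi0 chiV] : exists2 chi, chi != 0 &
    forall P, V P <-> (size P <= a.+2)%N /\ chi %| P.
  apply: (@truncated_ideal _ V a.+2).
  - move=> t P Q [Ps PV] [Qs QV]; split.
      apply: leq_trans (size_polyD _ _) _; rewrite geq_max Qs andbT.
      exact: leq_trans (size_scale_leq _ _) Ps.
    rewrite rmorphD /= evD memvD //.
    have -> : map_poly polyC (t *: P) = bimono t 0 0 * map_poly polyC P.
      by rewrite map_polyZ /bimono !expr0 alg_polyC mul_polyC alg_polyC.
    by rewrite evZ ?memvZ //; apply: tdeg_le_map_polyC.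
  - by move=> P [].
  - move=> P [Ps PV] Ps'; split.
      by apply: leq_trans (size_polyMleq _ _) _; rewrite size_polyX.
    have Pd : tdeg_le a (map_poly polyC P) by apply: tdeg_le_map_polyC.
    have Ed : map_poly polyC ('X * P) = bimono 1 1 0 * map_poly polyC P.
      by rewrite rmorphM /= map_polyX /bimono expr0 alg_polyC expr1 scale1r.
    rewrite Ed -ev_x //; apply: pencil_quotient_inj.
      by apply: (@gpartM _ _ _ _ 1 a) => //; apply: ev_gpart.
    rewrite quot_mulCA ev_z //; case/memv_amull: PV => t ta ->.
    by rewrite quot_mulCA amull_in //; apply: (@gpartM _ _ _ _ 1 a).
  exists (restr c F0); first by apply/Vrestr; rewrite ?F0z ?mem0v.
  apply/eqP => /polyP/(_ a.+1); rewrite coef_map coef0 /= /horner_eval.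
  have -> : F0`_a.+1 = (F0`_a.+1`_0)%:P.
    apply/polyP=> l; rewrite coefC; case: eqVneq => [->//|l0].
    by rewrite F0d // -[X in (X < _)%N]addn0 ltn_add2l lt0n.
  by rewrite hornerC; apply/eqP.
exists chi; last first.
  move=> F Fd Fz; suff /chiV[] : V (restr c F) by [].
  by apply/Vrestr; rewrite ?Fz ?mem0v.
rewrite ltnNge; apply/negP => chi1; apply: nsurj; apply/subvP => u /ev_surj[F Fd ->].
apply/Vrestr => //; apply/chiV; split; first exact: size_restr.
have /eqP s1 : size chi == 1%N by rewrite eqn_leq chi1 size_poly_gt0.
by rewrite (eqp_dvdl _ (_ : chi %= 1)) ?dvd1p // -size_poly_eq1 s1.
Qed.

Lemma ideal_common_factor :
    (forall c, ~ (A_ a.+1 <= h c ** A_ a)%VS) ->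
  exists2 G : P2, (1 < size G)%N &
    forall F, tdeg_le a.+1 F -> ev a.+1 F = 0 -> exists Q : P2, F = G * Q.
Proof.
move=> nsurj.
(* The largest ideal whose restriction to each line y = c has the same common
   divisors as the relations of degree a+1; it contains no nonzero polynomial in
   y alone, as such a polynomial would vanish at every c. *)
pose J (F : P2) := forall c (chi : {poly K}),
  (forall F', tdeg_le a.+1 F' -> ev a.+1 F' = 0 -> chi %| restr c F') ->
  chi %| restr c F.
have [||||G G1 GJ] := @common_factor K J.
- move=> F G JF JG c chi H; rewrite /restr rmorphB /= dvdp_sub //; first exact: JF.
  exact: JG.
- by move=> H F JF c chi chiI; rewrite /restr rmorphM /= dvdp_mull //; apply: JF.
- move=> p Jp; apply: (poly0_of_infinite K_infinite) => c.
  have [chi chi1 /Jp] := pencil_common_divisor (nsurj c).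
  rewrite /restr map_polyC /= /horner_eval => chip; apply/eqP/negPn/negP => pc.
  have := dvdp_leq _ chip; rewrite polyC_eq0 size_polyC pc => /(_ isT).
  by rewrite leqNgt chi1.
- exists F0; first by move=> c chi; apply.
  by apply: contraNneq F0t => ->; rewrite !coef0.
by exists G => // F Fd Fz; apply: GJ => c chi; apply.
Qed.

Section RelationFactor.
Variable G : P2.
Hypothesis G1 : (1 < size G)%N.
Hypothesis G_dvd :
  forall F, tdeg_le a.+1 F -> ev a.+1 F = 0 -> exists Q : P2, F = G * Q.

Let e := tdeg G.
Let n := (a.+1 - e)%N.
Let g := ev e G.

Let G0 : G != 0.
Proof. by rewrite -size_poly_gt0; apply: leq_trans G1. Qed.

Let Ge : tdeg_le e G := @tdeg_le_tdeg _ G.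
Let ge : g \in A_ e. Proof. exact: ev_gpart. Qed.

Let ev_factor m Q : tdeg_le m Q -> g * ev m Q = ev (e + m) (G * Q).
Proof. by move=> Qm; rewrite evM. Qed.

Let cofactor_deg d Q : tdeg_le d (G * Q) -> Q != 0 ->
  (e <= d)%N /\ tdeg_le (d - e) Q.
Proof. by move=> GQ Q0; apply: tdeg_le_factor. Qed.

Lemma relation_cofactor :
  exists Q0, [/\ (e + n = a.+1)%N, tdeg_le n Q0, F0 = G * Q0,
                 G`_e`_0 != 0 & Q0`_n`_0 != 0].
Proof.
have [Q0 F0E] := G_dvd F0d F0z.
have Q0n0 : Q0 != 0.
  by apply: contraNneq F0t => Q00; rewrite F0E Q00 mulr0 !coef0.
have [|ea Q0d] := @cofactor_deg a.+1 Q0 _ Q0n0; first by rewrite -F0E.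
have en : (e + n = a.+1)%N by rewrite subnKC.
exists Q0; split=> //; move: F0t; rewrite F0E -en coef_top_mul //;
  by rewrite mulf_eq0 negb_or => /andP[].
Qed.

(** The part of degree a of gA, which is zero when [G] has degree a+1. *)
Let S := if (e <= a)%N then (g ** A_ (a - e))%VS else 0%VS.

(** z is injective from degree a to degree a+1 on A/gA, because it is so on the
    quotient of the polynomial ring by [G]: dehomogenization does not see z. *)
Lemma factor_z_inj u : u \in A_ a -> z * u \in (g ** A_ n)%VS -> u \in S.
Proof.
have [_ [en _ _ _ _]] := relation_cofactor.
move=> /ev_surj[P Pd ->]; rewrite ev_z // => /memv_amull[v /ev_surj[Q Qd ->]].
rewrite ev_factor // en => E.
have [Q' PE] : exists Q', P = G * Q'.
  have [||Q' PE] := G_dvd (F := P - G * Q).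
  - apply: tdeg_leB; first exact: tdeg_le_widen Pd.
    by rewrite -en; apply: tdeg_leM.
  - by rewrite evB E subrr.
  by exists (Q' + Q); rewrite mulrDr -PE subrK.
have [->|P0] := eqVneq P 0; first by rewrite ev0 mem0v.
have Q'0 : Q' != 0 by apply: contraNneq P0 => Q'0; rewrite PE Q'0 mulr0.
have [|ea Q'd] := @cofactor_deg a Q' _ Q'0; first by rewrite -PE.
have := ev_factor Q'd; rewrite subnKC // => PEv.
by rewrite /S ea PE -PEv amull_in // ev_gpart.
Qed.

(** y^(a+1) is missing: modulo z the form [G] contains x^e with e > 0, so it does
    not divide y^(a+1). *)
Lemma factor_z_not_onto : ~ (A_ a.+1 <= z ** A_ a + g ** A_ n)%VS.
Proof.
have [_ [en _ _ Gt _]] := relation_cofactor.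
have yd : tdeg_le a.+1 (bimono (1 : K) 0 a.+1) by apply: tdeg_le_bimono.
move=> /subvP/(_ _ (ev_gpart yd))/memv_addP.
case=> _ /memv_amull[_ /ev_surj[P Pd ->] ->].
case=> _ /memv_amull[_ /ev_surj[Q Qd ->] ->]; rewrite ev_factor // en ev_z // => E.
have yPd : tdeg_le a.+1 (bimono 1 0 a.+1 - P).
  by apply: tdeg_leB => //; apply: tdeg_le_widen Pd.
have [||Q' FE] := G_dvd (F := bimono 1 0 a.+1 - P - G * Q).
- by apply: tdeg_leB => //; rewrite -en; apply: tdeg_leM.
- by rewrite !evB E addrAC addrK subrr.
have yPE : bimono 1 0 a.+1 - P = G * (Q' + Q) by rewrite mulrDr -FE subrK.
have yP0 : bimono 1 0 a.+1 - P != 0.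
  apply/eqP => yP0; have : (bimono 1 0 a.+1 - P)`_0`_a.+1 = 0 by rewrite yP0 !coef0.
  rewrite !coefB coef_bimono !eqxx mulr1 Pd // subr0.
  by move/eqP; rewrite oner_eq0.
have Q0 : Q' + Q != 0 by apply: contraNneq yP0 => Q0; rewrite yPE Q0 mulr0.
have [|_ Q2d] := @cofactor_deg a.+1 _ _ Q0; first by rewrite -yPE.
by apply: (@top_form_not_unit _ e n G (Q' + Q) P); rewrite ?en // tdeg_gt0.
Qed.

Lemma factor_rank_lt : (\dim (g ** A_ n) < \dim S)%N.
Proof.
have [_ [en _ _ _ _]] := relation_cofactor.
have D := dim_preim_add (amull z) (A_ a) (g ** A_ n).
have sumlt : (\dim (z ** A_ a + g ** A_ n) < \dim (A_ a.+1))%N.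
  rewrite ltnNge; apply/negP => le; apply: factor_z_not_onto.
  have sub : (z ** A_ a + g ** A_ n <= A_ a.+1)%VS.
    by rewrite subv_add (@amull_gpart_sub _ _ _ 1) //= -en amull_gpart_sub.
  by rewrite -(dimv_leqif_sup sub) eqn_leq le dimvS.
have preS : (\dim (A_ a :&: amull z @^-1: (g ** A_ n)) <= \dim S)%N.
  apply/dimvS/subvP => u; rewrite memv_cap -memv_preim lfunE => /andP[].
  exact: factor_z_inj.
have da : \dim (A_ a) = s by apply: dim_s; move: ab2; clear; lia.
have da1 : \dim (A_ a.+1) = s by apply: dim_s; move: ab2; clear; lia.
by move: D sumlt preS; rewrite da da1; clear; lia.
Qed.

(** [factor_rank_lt] contradicts the growth of the Hilbert function of gA before
    the middle, obtained from [rank_defect_mono] between degrees n and b of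
    A/(0 : g) and [rank_duality] for g and g y. *)
Lemma no_common_factor : False.
Proof.
have [Q0 [en Q0d F0E _ Q0t]] := relation_cofactor.
have ea : (e <= a)%N.
  rewrite leqNgt; apply/negP => ae.
  by have := factor_rank_lt; rewrite /S (leqNgt e a) ae dimv0.
have := factor_rank_lt; rewrite /S ea; apply/negP; rewrite -leqNgt.
have nE : n = (a - e).+1 by rewrite /n subSn.
have gen m : (a - e < m)%N -> (g ** A_ m.+1 <= (g * y) ** A_ m + (g * z) ** A_ m)%VS.
  move=> am; apply: (@top_power_mem g (a - e) Q0); rewrite -?nE //; last exact: ltnW.
  by rewrite ev_factor // en -F0E.
have := rank_defect_mono gen y1 z1 (b - n); rewrite -nE.
have gy : g * y \in A_ (e + 1) by apply: gpartM.
have [-> ->] : (a - e + (b - n)).+1 = b /\ (a - e + (b - n))%N = b.-1.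
  by move: nE ab2; move: n; clear => n; lia.
rewrite (rank_duality A_gor dim_top dim_above ge (i := b)); last first.
  by move: ea abj; clear; lia.
rewrite (rank_duality A_gor dim_top dim_above gy (i := b.-1)); last first.
  by move: ea abj ab2; clear; lia.
have -> : (j - (e + b) = a - e)%N by move: ea abj; clear; lia.
have -> : (j - (e + 1 + b.-1) = a - e)%N by move: ea abj ab2; clear; lia.
by rewrite leq_add2r.
Qed.

End RelationFactor.

Lemma exists_surjective_linear_form :
  exists2 w : A, w \in A_ 1 & (A_ a.+1 <= w ** A_ a)%VS.
Proof.
apply: NNPP => nex.
have [|G G1 GI] := ideal_common_factor; last exact: (no_common_factor G1 GI).
by move=> c sub; apply: nex; exists (h c).
Qed.

End Core.
End Coordinates.

(** * Constancy of the rank *)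

Section Assembly.
Variables (K : fieldType) (A : gradedArtinianQuotient K).
Hypothesis K_infinite : forall e : seq K, exists c : K, c \notin e.
Local Notation pi := (quot_proj A).
Local Notation A_ i := (gpart A i).
Local Notation "w ** U" := (amull w @: U)%VS (at level 40).

(** If no form of degree a+1 vanished in [A], multiplication by the first variable
    x would be injective on A_a, hence onto A_(a+1) by dimension; then the power
    y^(a+1) of the second variable would be divisible by x. *)
Lemma exists_relation a : \dim (A_ a) = \dim (A_ a.+1) ->
  exists f : {mpoly K[3]}, [/\ f \is (a.+1).-homog, f != 0 & pi f = 0].
Proof.
move=> dE; apply: NNPP => nex.
have inj (f : {mpoly K[3]}) : f \is (a.+1).-homog -> pi f = 0 -> f = 0.
  by move=> fd fz; apply/eqP/negPn/negP => f0; apply: nex; exists f.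
have var1 i : (mpolyX K U_(i) : {mpoly K[3]}) \is 1.-homog by rewrite dhomogX /= mdeg1.
pose x : {mpoly K[3]} := mpolyX K U_(0%R).
pose y : {mpoly K[3]} := mpolyX K U_(1%R).
have x0 : x != 0.
  by apply/eqP => /(congr1 (mcoeff U_(0%R)))/eqP; rewrite mcoeffX eqxx mcoeff0 oner_eq0.
have x1 : x \is 1.-homog := var1 _; have y1 : y \is 1.-homog := var1 _.
have xA : (pi x ** A_ a = A_ a.+1)%VS.
  apply/eqP; rewrite -dimv_leqif_eq; last first.
    by apply: (@amull_gpart_sub _ _ _ 1); apply: gpart_homog.
  rewrite limg_dim_eq ?dE //; apply/eqP; rewrite -subv0; apply/subvP => u.
  rewrite memv_cap memv_ker lfunE memv0 /= => /andP[/mem_gpart[f fd ->]].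
  rewrite -rmorphM => /eqP/inj xf; have /eqP := xf (dhomogM x1 fd).
  by rewrite mulf_eq0 (negbTE x0) /= => /eqP ->; rewrite raddf0.
have yd : y ^+ a.+1 \is (a.+1).-homog by rewrite -[X in X.-homog]mul1n dhomogMn.
have := gpart_homog A yd; rewrite -xA => /memv_amull[_ /mem_gpart[f fd ->]].
rewrite -rmorphM => /eqP; rewrite -subr_eq0 -raddfB => /eqP/inj.
move=> /(_ (rpredB yd (dhomogM x1 fd))).
move=> /(congr1 (meval (fun i : 'I_3 => (i == 1)%:R))).
rewrite mevalB mevalM rmorphXn /= !mevalXU /= mul0r subr0 expr1n meval0.
by move/eqP; rewrite oner_eq0.
Qed.

(** The coefficient of x^(a+1) in the new coordinates is the value of the relation
    at (1 : p1 : p2), so (p1, p2) is any point where its dehomogenization by the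
    first variable is nonzero. *)
Lemma exists_coordinates a : \dim (A_ a) = \dim (A_ a.+1) ->
  exists p1 p2 F, [/\ tdeg_le a.+1 F, ev A p1 p2 a.+1 F = 0 & F`_a.+1`_0 != 0].
Proof.
move=> /exists_relation[f [fd f0 fz]].
have [F Fd fE] : exists2 F, tdeg_le a.+1 F &
    f = homogenize (mpolyX K U_(1%R)) (mpolyX K U_(2%R)) (mpolyX K U_(0%R)) a.+1 F.
  pose v (l : 'I_3) : {poly {poly K}} :=
    nth 0 [:: bimono 1 0 0; bimono 1 1 0; bimono 1 0 1] l.
  apply: (@homogenize_surj K _ _ _ v _ _ a.+1 f fd).
    by move=> [[|[|[|l]]] lt] //; rewrite /v /=; apply: tdeg_le_bimono.
  have XE (l l' : 'I_3) : l = l' :> nat -> mpolyX K U_(l) = mpolyX K U_(l').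
    by move=> /val_inj ->.
  move=> [[|[|[|l]]] lt] //; rewrite /v /= homogenize_bimono //;
    by rewrite ?subn0 ?subnn !expr0 !expr1 !scale1r ?mul1r ?mulr1; apply: XE.
have F0 : F != 0 by apply: contraNneq f0 => F0; rewrite fE F0 homogenize0.
have [p1 [p2 nz]] := restr_nonvanishing K_infinite F0.
have [G Gd fG] := coordinate_form p1 p2 fd.
exists p1, p2, G; split=> //; first by rewrite /ev -fG.
pose w (i : 'I_3) : K := nth 0 [:: 1; p1; p2] i.
have <- : f.@[w] = G`_a.+1`_0.
  rewrite fG meval_homogenize_top ?mevalXU //.
  - by rewrite mevalB mevalZ !mevalXU mulr1 subrr.
  - by rewrite mevalB mevalZ !mevalXU mulr1 subrr.
by rewrite fE meval_homogenize_affine ?mevalXU.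
Qed.

(** The conclusion for all i follows from that for i = a because l^p commutes
    with [w], which is injective on A_(i+p) as long as i + p < b. *)
Lemma mult_rank_const j a b s (l : A) :
    gorenstein A -> \dim (A_ j) = 1%N ->
    (forall i, (j < i)%N -> \dim (A_ i) = 0%N) ->
    (a + b = j)%N -> (a + 2 <= b)%N ->
    (forall i, (a <= i <= b)%N -> \dim (A_ i) = s) ->
    l \in A_ 1 ->
  forall p i, (a <= i)%N -> (i + p <= b)%N -> mult_rank l p i = mult_rank l p a.
Proof.
move=> A_gor dim_top dim_above abj ab2 dim_s l1.
have [|p1 [p2 [F [Fd Fz Ft]]]] := @exists_coordinates a.
  by rewrite !dim_s //; lia.
have [w w1 wa] := exists_surjective_linear_form K_infinite A_gor dim_top dim_above
  abj ab2 dim_s Fd Fz Ft.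
have w_onto i : (a <= i)%N -> (w ** A_ i = A_ i.+1)%VS.
  move=> ai; apply/eqP; rewrite eqEsubv (@amull_gpart_sub _ _ _ 1) //=.
  rewrite -(subnKC ai); elim: (i - a)%N => [|k IHk]; first by rewrite addn0.
  rewrite addnS; apply: gpartS_sub => n u /(subvP IHk)/memv_amull[v vk ->].
  rewrite quot_mulCA amull_in //; apply: (@gpartM _ _ _ _ 1) => //; exact: gpart_var.
have w_inj i : (a <= i)%N -> (i < b)%N -> (A_ i :&: lker (amull w) = 0)%VS.
  move=> ai ib; apply/eqP; rewrite -dimv_eq0.
  have := limg_ker_dim (amull w) (A_ i); rewrite w_onto // !dim_s; lia.
move=> p i ai; rewrite -(subnKC ai); elim: (i - a)%N => [|k IHk]; first by rewrite addn0.
move=> kb; rewrite -IHk; last by move: kb; lia.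
rewrite /mult_rank addnS -w_onto ?leq_addr // amull_comm limg_dim_eq //.
apply/eqP; rewrite -subv0 -(w_inj (p + (a + k))%N); [|lia|by move: kb; lia].
apply: capvS; last exact: subvv.
by apply: amull_gpart_sub; rewrite -[X in A_ X]mul1n gpartXn.
Qed.

End Assembly.

Local Close Scope ring_scope.

Theorem lemma2p15 (K : fieldType)
    (K_infinite : forall e : seq K, exists x : K, x \notin e)
    (T T1 : seq nat) (s k j a b : nat)
    (T_gor : codim3_gorenstein_seq K T)
    (T_size : size T = j.+1)
    (T_form : T = [:: 1; 3] ++ T1 ++ nseq k s ++ rev T1 ++ [:: 3; 1])
    (s_max : s = \max_(t <- T) t)
    (s_thrice : 3 <= count_mem s T)
    (ab_range : forall i : nat, (a <= i <= b) = (nth 0 T i == s))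
    (A : gradedArtinianQuotient K) (A_Gor : in_Gor A T)
    (l : A) (l_lin : l \in gpart A 1) :
  (forall p i i' : nat,
     a <= i -> i + p <= b -> a <= i' -> i' + p <= b ->
     mult_rank l p i = mult_rank l p i')
  /\
  (forall u v u' v' : 'I_j.+1,
     nth 0 T u = s -> nth 0 T v = s -> nth 0 T u' = s -> nth 0 T v' = s ->
     u + v' = u' + v ->
     rank_matrix l j u v = rank_matrix l j u' v').
Proof.
have [A_gor hilbE] := A_Gor.
have dimE i : \dim (gpart A i) = nth 0 T i := hilbE i.
have dim_top : \dim (gpart A j) = 1.
  by rewrite dimE -[j]/(j.+1.-1) -T_size nth_last T_form /= !last_cat.
have dim_above i : j < i -> \dim (gpart A i) = 0.
  by move=> ji; rewrite dimE nth_default // T_size.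
have s_gt0 : 0 < s by rewrite s_max T_form /= big_cons leq_max.
have ab2 : a + 2 <= b.
  have : count_mem s T <= b.+1 - a.
    rewrite -[T in count_mem s T](mkseq_nth 0) /mkseq count_map -size_filter.
    rewrite -(size_iota a (b.+1 - a)) uniq_leq_size ?filter_uniq ?iota_uniq //.
    move=> i; rewrite mem_filter /= -ab_range !mem_iota => /andP[/andP[ai ib] _].
    by rewrite ai /=; move: ai ib; clear; lia.
  by move: s_thrice; clear; lia.
have ss i : a <= i <= b -> nth 0 T i = s by rewrite ab_range => /eqP.
have le_j i : a <= i <= b -> i <= j.
  move=> /ss Ti; rewrite leqNgt; apply/negP => /dim_above.
  by rewrite dimE Ti => s0; move: s_gt0; rewrite s0.
have sym i : a <= i <= b -> a <= j - i <= b.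
  move=> iab; rewrite ab_range -(ss i iab) -!dimE.
  have := rank_duality A_gor dim_top dim_above (gpart1 A) (le_j i iab).
  by rewrite amull1 !lim1g add0n => ->.
have abj : a + b = j.
  have /sym : a <= a <= b by move: ab2; clear; lia.
  have bb : a <= b <= b by move: ab2; clear; lia.
  by move: (sym _ bb) (le_j _ bb) ab2; clear; lia.
have dim_s i : a <= i <= b -> \dim (gpart A i) = s by rewrite dimE; apply: ss.
have rank_a p i : a <= i -> i + p <= b -> mult_rank l p i = mult_rank l p a.
  by move=> ai ib; apply: (mult_rank_const K_infinite A_gor dim_top dim_above abj ab2 dim_s).
split=> [p i i' ai ib ai' ib'|u v u' v' /eqP + /eqP + /eqP + /eqP].
  by rewrite !rank_a.
rewrite -!ab_range => /andP[au _] /andP[_ vb] /andP[au' _] /andP[_ vb'] uv.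
rewrite !mxE (_ : (u' <= v') = (u <= v)); last by move: uv; clear; lia.
case: leqP => // uv_le.
have -> : v' - u' = v - u by move: uv uv_le; clear; lia.
by rewrite !rank_a //; move: uv uv_le vb vb'; clear; lia.
Qed.
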